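(* The set $\mathcal P:=\{f\in\mathcal M\mid\forall\beta\in2^\omega\ \ \mathrm{osc}(f,\beta)=0\}$ of everywhere converging martingales is ${\bf\Pi}^1_1$-complete.
   Context: $2^{<\omega}$ is the set of finite binary sequences, $2^\omega$ the Cantor space; for $\beta\in 2^\omega$, $\beta|l$ is the initial segment of $\beta$ of length $l$. A martingale is a map $f:2^{<\omega}\to[0,1]$ such that $f(s)=\frac{f(s0)+f(s1)}{2}$ for each $s\in 2^{<\omega}$. The set of martingales is denoted $\mathcal M$; it is a compact subset of $[0,1]^{2^{<\omega}}$ (product topology), with the induced topology. For $f\in\mathcal M$ and $\beta\in2^\omega$, $\mathrm{osc}(f,\beta):=\inf_{N\in\omega}\sup_{p,q\geq N}|f(\beta|p)-f(\beta|q)|$ (so $\mathrm{osc}(f,\beta)=0$ iff $(f(\beta|l))_{l\in\omega}$ converges). A subset $C$ of a Polish space $X$ is ${\bf\Gamma}$-complete if $C\in{\bf\Gamma}(X)$ and for every zero-dimensional Polish space $Z$ and every $D\in{\bf\Gamma}(Z)$ there is a continuous $g:Z\to X$ with $D=g^{-1}(C)$. ${\bf\Pi}^1_1$ is the class of co-analytic sets. *)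

(* Defs.v *)
From HB Require Import structures.
From mathcomp Require Import all_boot all_order all_algebra.
From mathcomp Require Import all_classical all_reals.
From mathcomp Require Import topology normedtype cantor.

Set Implicit Arguments.
Unset Strict Implicit.
Unset Printing Implicit Defensive.

Import Order.TTheory GRing.Theory Num.Theory.
Import numFieldNormedType.Exports.

Local Open Scope classical_set_scope.
Local Open Scope ring_scope.

Definition separable (T : topologicalType) : Prop :=
  exists2 S : set T, countable S & dense S.

(* The metric is an explicit function, required to induce the topology that T
   already has: Polishness is a property of topological spaces. Nonnegativity
   of d follows from the three metric axioms. *)
Definition completely_metrizable (R : realType) (T : topologicalType) : Prop :=
  exists d : T -> T -> R,
    [/\ (forall x y, d x y = 0 <-> x = y),
        (forall x y, d x y = d y x),
        (forall x y z, d x z <= d x y + d y z),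
        (forall (x : T) (A : set T), nbhs x A <->
           exists2 e : R, 0 < e & [set y | d x y < e] `<=` A) &
        (forall u : nat -> T,
           (forall e : R, 0 < e ->
              exists N, forall m n, (N <= m)%N -> (N <= n)%N ->
                d (u m) (u n) < e) ->
           exists l : T, u @ \oo --> l)].

Definition polish (R : realType) (T : topologicalType) : Prop :=
  separable T /\ completely_metrizable R T.

(* MathComp-Analysis's [zero_dimensional] only asks that distinct points be
   separated by a clopen set, which is strictly weaker, even for Polish spaces
   (complete Erdos space). *)
Definition has_clopen_basis (T : topologicalType) : Prop := basis (@clopen T).

(* Y may be empty, so the empty set is analytic. *)
Definition analytic (R : realType) (X : topologicalType) (A : set X) : Prop :=
  exists Y : topologicalType, polish R Y /\
    exists2 f : Y -> X, continuous f & A = range f.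

Definition coanalytic (R : realType) (X : topologicalType) (A : set X) : Prop :=
  analytic R (~` A).

Definition pointclass := forall X : topologicalType, set X -> Prop.

Definition pointclass_complete (R : realType) (Gamma : pointclass)
    (X : topologicalType) (C : set X) : Prop :=
  [/\ polish R X,
      Gamma X C &
      forall Z : topologicalType, polish R Z -> has_clopen_basis Z ->
      forall D : set Z, Gamma Z D ->
      exists2 g : Z -> X, continuous g & D = g @^-1` C].

Definition Pi11_complete (R : realType) (X : topologicalType) (C : set X) :
    Prop :=
  pointclass_complete R (@coanalytic R) C.

(* Used as a type, [martingale R] carries the subspace topology inherited from
   the product topology on R^(2^<omega). *)
Definition martingale (R : realType) : set {ptws seq bool -> R} :=
  [set f | (forall s, 0 <= f s <= 1) /\
           (forall s, f s = (f (rcons s false) + f (rcons s true)) / 2)].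
Arguments martingale R : clear implicits.

Definition initial_segment (beta : cantor_space) (l : nat) : seq bool :=
  mkseq beta l.

(* The real [sup] and [inf] are the intended ones when f takes its values in
   [0, 1]: the sets are then nonempty and bounded. *)
Definition osc (R : realType) (f : seq bool -> R) (beta : cantor_space) : R :=
  inf [set sup [set `|f (initial_segment beta p) - f (initial_segment beta q)|
                 | p in [set p | (N <= p)%N] & q in [set q | (N <= q)%N]]
      | N in [set: nat]].

Definition everywhere_converging (R : realType) : set (martingale R) :=
  [set f | forall beta : cantor_space, osc (set_val f) beta = 0].
Arguments everywhere_converging R : clear implicits.

(* Main.v *)
Require Import Defs.
From mathcomp Require Import all_boot all_order all_algebra.
From mathcomp Require Import all_classical all_reals.
From mathcomp Require Import topology normedtype cantor.
From mathcomp Require Import lra.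
Import numFieldNormedType.Exports.

(** A martingale f fails to converge along some branch iff there are e > 0 and
    strings u_0, u_1, ..., each a proper prefix of the next, with
    |f(u_n) - f(u_(n+1))| >= e for all n.  The triples (f, e, u) form a closed
    set of real functions on a countable set, hence a Polish space, and the set
    of non-converging martingales is its projection.

    For hardness, let D be coanalytic in a zero-dimensional Polish space Z, and
    let h : Y -> Z be continuous with range ~D.  Covering Y by countably many
    small sets and Z by countably many small clopen sets, at every scale, gives
    trees T(z) on the natural numbers such that T(z) has an infinite branch iff
    z is in the range of h, and such that each condition "s is in T(z)" is
    clopen in z.  An infinite branch (a_0, a_1, ...) of T(z) is coded by the
    binary sequence 0^a_0 100 0^a_1 100 ...; the martingale attached to T(z)
    goes through 1/2, 3/4, 1/2 during each block 100 that stays in T(z), and is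
    constant from the moment the binary sequence is not of this form, or leaves
    T(z).  It therefore diverges exactly along the codes of branches of T(z). *)

Set Implicit Arguments.
Unset Strict Implicit.
Unset Printing Implicit Defensive.

Import Order.TTheory GRing.Theory Num.Theory.

Local Open Scope classical_set_scope.
Local Open Scope ring_scope.

(** * Convergence in subspaces of products *)

Lemma subtype_cvg (X : topologicalType) (C : set X) (F : set_system C) (x : C) :
  Filter F -> (set_val @ F --> set_val x) -> F --> x.
Proof.
move=> FF Fx A [_ [[B oB <-] Bx BA]]; apply: filterS BA _.
by apply: Fx; exact: open_nbhs_nbhs.
Qed.

Lemma ptws_cvg (R : realType) (I : choiceType)
    (F : set_system {ptws I -> R}) (f : {ptws I -> R}) : Filter F ->
  (forall i, (fun g : {ptws I -> R} => g i) @ F --> f i) -> F --> f.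
Proof.
move=> FF Ff; rewrite cvg_sup => i; apply/cvg_image.
  (* Constant functions show that evaluation at [i] is surjective, as [cvg_image] requires. *)
  by rewrite eqEsubset; split=> v // _; exists (cst v).
move=> A /(Ff i) FA; exists ((fun g => g i) @^-1` A); first exact: FA.
by rewrite image_preimage// eqEsubset; split=> v // _; exists (cst v).
Qed.

Lemma subtype_ptws_cvg (R : realType) (I : choiceType) (C : set {ptws I -> R})
    (F : set_system C) (x : C) : Filter F ->
  (forall i, (fun y : C => set_val y i) @ F --> set_val x i) -> F --> x.
Proof.
by move=> FF Fx; apply: subtype_cvg; exact: ptws_cvg.
Qed.

Lemma ptws_eval_continuous (R : realType) (I : choiceType) (i : I) :
  continuous (fun f : {ptws I -> R} => f i : R).
Proof. exact: (@proj_continuous I (fun=> R) i). Qed.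

Lemma subtype_eval_continuous (R : realType) (I : choiceType)
    (C : set {ptws I -> R}) (i : I) :
  continuous (fun y : C => set_val y i : R).
Proof.
move=> y; have := @initial_continuous C {ptws I -> R} set_val y.
move=> Hy; exact: (cvg_comp _ _ Hy (@ptws_eval_continuous R I i _)).
Qed.

(** * Closed subspaces of countable powers of the real line *)

(** These weights tend to 0 along the enumeration of [I]; truncating each coordinate gap at its
    weight makes the supremum below induce the product topology instead of the uniform one. *)
Definition coord_weight (R : realType) (I : countType) (i : I) : R :=
  (pickle i).+1%:R^-1.
Arguments coord_weight R {I} i.

(* Adjoining 0 keeps the set nonempty when I is empty. *)
Definition coord_dist (R : realType) (I : countType) (f g : I -> R) : R :=
  sup (0 |` range (fun i => Num.min `|f i - g i| (coord_weight R i))).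

Section coord_dist.
Variables (R : realType) (I : countType).
Implicit Types (f g h : I -> R) (i : I) (e : R).

Lemma coord_weight_gt0 i : 0 < coord_weight R i.
Proof. by rewrite invr_gt0 ltr0n. Qed.

Lemma coord_weight_le1 i : coord_weight R i <= 1.
Proof. by rewrite invf_le1 ?ltr0n// ler1n. Qed.

Lemma coord_dist_le f g e : 0 <= e ->
  (coord_dist f g <= e) <->
  forall i, Num.min `|f i - g i| (coord_weight R i) <= e.
Proof.
move=> e0; split=> [dfg i|H].
  apply: le_trans dfg; apply: ub_le_sup; last by right; exists i.
  exists 1 => _ [->//|[j _ <-]].
  by rewrite ge_min coord_weight_le1 orbT.
by apply: ge_sup; [exists 0; left | move=> _ [->//|[j _ <-]]].
Qed.

Lemma coord_dist_ge f g i :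
  Num.min `|f i - g i| (coord_weight R i) <= coord_dist f g.
Proof.
apply: ub_le_sup; last by right; exists i.
by exists 1 => _ [->//|[j _ <-]]; rewrite ge_min coord_weight_le1 orbT.
Qed.

Lemma coord_dist_ge0 f g : 0 <= coord_dist f g.
Proof.
apply: ub_le_sup; last by left.
by exists 1 => _ [->//|[j _ <-]]; rewrite ge_min coord_weight_le1 orbT.
Qed.

Lemma coord_dist_eq0 f g : coord_dist f g = 0 <-> f = g.
Proof.
split=> [d0|<-].
  apply/funext => i; apply/eqP; rewrite -subr_eq0 -normr_le0.
  have := coord_dist_ge f g i; rewrite d0 ge_min => /orP[//|].
  by rewrite leNgt coord_weight_gt0.
apply/eqP; rewrite eq_le coord_dist_ge0 andbT.
by apply/(coord_dist_le f f (lexx 0)) => i; rewrite subrr normr0 ge_min lexx.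
Qed.

Lemma coord_dist_sym f g : coord_dist f g = coord_dist g f.
Proof.
by rewrite /coord_dist; under eq_fun do rewrite distrC.
Qed.

Lemma coord_dist_triangle f g h :
  coord_dist f h <= coord_dist f g + coord_dist g h.
Proof.
apply/coord_dist_le; first by rewrite addr_ge0 ?coord_dist_ge0.
move=> i.
apply: le_trans (lerD (coord_dist_ge f g i) (coord_dist_ge g h i)).
have := ler_distD (g i) (f i) (h i); have := coord_weight_gt0 i.
have := normr_ge0 (f i - g i); have := normr_ge0 (g i - h i).
rewrite !minElt; do 3 case: ifP; lra.
Qed.

Lemma coord_dist_lt f g i e :
  coord_dist f g < Num.min e (coord_weight R i) -> `|f i - g i| < e.
Proof.
rewrite lt_min => /andP[de dw]; have := coord_dist_ge f g i.
by rewrite ge_min => /orP[/le_lt_trans->//|]; rewrite leNgt dw.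
Qed.

(** Past some [K] the weights are below [e], so only finitely many coordinates can matter. *)
Lemma coord_dist_near e : 0 < e -> exists K : nat, forall f g,
  (forall i, (pickle i < K)%N -> `|f i - g i| <= e) -> coord_dist f g <= e.
Proof.
move=> e0; have [K] := ltr_add_invr e0; rewrite add0r => Ke.
exists K => f g fg; apply/coord_dist_le; [exact: ltW | move=> i].
rewrite ge_min; have [/fg ->//|Ki] := ltnP (pickle i) K.
apply/orP; right; apply: le_trans (ltW Ke).
by rewrite lef_pV2 ?posrE ?ltr0n// ler_nat.
Qed.

End coord_dist.

Lemma subtype_nbhs_coord_dist (R : realType) (I : countType)
    (C : set {ptws I -> R}) (x : C) (A : set C) :
  nbhs x A <-> exists2 e : R, 0 < e &
    [set y : C | coord_dist (set_val x) (set_val y) < e] `<=` A.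
Proof.
split=> [|[e e0 eA]].
  pose B (e : R) := [set y : C | coord_dist (set_val x) (set_val y) < e].
  (* Convergence to [x] of the filter generated by the balls says exactly that each neighbourhood of
     [x] contains a ball, and it can be checked coordinatewise. *)
  pose F := filter_from [set e : R | 0 < e] B.
  suff Fx : F --> x by move=> /Fx[e e0 eA]; exists e.
  have FF : Filter F.
    apply: filter_from_filter; first by exists 1 => /=.
    move=> e1 e2 e10 e20; exists (Num.min e1 e2) => /=.
      by rewrite lt_min e10.
    by move=> y; rewrite /B /= lt_min => /andP[].
  apply: subtype_ptws_cvg => i; apply/cvgrPdist_lt => e e0.
  exists (Num.min e (coord_weight R i)) => /=.
    by rewrite lt_min e0 coord_weight_gt0.
  by move=> y; exact: coord_dist_lt.
have e20 : 0 < e / 2 by rewrite divr_gt0.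
have [K KP] := coord_dist_near I e20.
suff : nbhs x [set y : C | forall i, (pickle i < K)%N ->
    `|set_val x i - set_val y i| <= e / 2].
  apply: filterS => y /KP xy; apply: eA => /=; apply: le_lt_trans xy _; lra.
(* A finite intersection of neighbourhoods, one for each [K]; a [K] that codes no index gives a
   vacuous condition. *)
elim: K {KP} => [|K IH]; first exact: (@nearW _ _ _ (nbhs_filter x)).
have HK : nbhs x [set y : C | forall i, pickle i = K ->
    `|set_val x i - set_val y i| <= e / 2].
  have [[i iK]|nK] := pselect (exists i : I, pickle i = K); last first.
    by apply: (@nearW _ _ _ (nbhs_filter x)) => y i iK; case: nK; exists i.
  have /cvgrPdist_le/(_ _ e20) := @subtype_eval_continuous R I C i x.
  apply: filterS => y xy j; rewrite -iK => /(pcan_inj pickleK) ->.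
  exact: xy.
apply: filterS2 IH HK => y H1 H2 i; rewrite ltnS leq_eqVlt.
by case/orP=> [/eqP/H2//|/H1].
Qed.

(** Rational points need not lie in [C]. For each finite list of rationals and each precision, one
    picks instead a point of [C] that close to the list, if there is one, and [x0] or an arbitrary
    point otherwise. *)
Lemma closed_ptws_separable (R : realType) (I : countType)
    (C : set {ptws I -> R}) : separable C.
Proof.
pose near_code (c : seq rat * nat) (y : C) :=
  forall i, (pickle i < size c.1)%N ->
    `|set_val y i - ratr (nth 0 c.1 (pickle i))| < c.2.+1%:R^-1.
have [[x0 _]|C0] := pselect (exists x : C, True); last first.
  by exists set0 => // O [x _] _; case: C0; exists x.
pose u n := oapp (fun c => xget x0 (near_code c)) x0 (unpickle n).
exists (range u); first exact: card_image_le.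
move=> O [x Ox] oO.
have /subtype_nbhs_coord_dist[e e0 eO] : nbhs x O by exact: open_nbhs_nbhs.
have e20 : 0 < e / 2 by rewrite divr_gt0.
have [K KP] := coord_dist_near I e20.
(* The given point and the picked one are both within e/4 of the same rationals, hence within e/2 of
   each other on the first [K] coordinates. *)
have e40 : 0 < e / 4 by rewrite divr_gt0.
have [k] := ltr_add_invr e40; rewrite add0r => ke.
have k0 : 0 < k.+1%:R^-1 :> R by rewrite invr_gt0 ltr0n.
have rat_near (r d : R) : 0 < d -> exists q : rat, `|r - ratr q| < d.
  move=> d0; have : r - d < r + d by lra.
  move=> /rat_in_itvoo[q]; rewrite in_itv /= => /andP[rq qr].
  by exists q; rewrite ltr_norml; lra.
have /choice[q qP] : forall n, exists q : rat, forall i, pickle i = n ->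
    `|set_val x i - ratr q| < k.+1%:R^-1.
  move=> n; have [[i <-]|nK] := pselect (exists i : I, pickle i = n).
    have [q qx] := rat_near (set_val x i) _ k0.
    by exists q => j /(pcan_inj pickleK) ->.
  by exists 0 => i iK; case: nK; exists i.
pose c := (mkseq q K, k).
have xc : near_code c x.
  by move=> i; rewrite /= size_mkseq => iK; rewrite nth_mkseq//; exact: qP.
exists (u (pickle c)); split; last by exists (pickle c).
rewrite /u pickleK /=.
have yc : near_code c (xget x0 (near_code c)).
  by case: xgetP => [y _ //|/(_ x)].
apply: eO => /=; apply: le_lt_trans (_ : e / 2 < e); last by lra.
apply: KP => i iK; have := xc i; have := yc i.
rewrite /= size_mkseq iK => /(_ isT) H1 /(_ isT) H2.
move: H1 H2 ke; set d : R := _^-1; rewrite !ltr_norml ler_norml; lra.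
Qed.

Lemma closed_ptws_polish (R : realType) (I : countType)
    (C : set {ptws I -> R}) : closed C -> polish R C.
Proof.
move=> clC; split; first exact: closed_ptws_separable.
exists (fun x y => coord_dist (set_val x) (set_val y)); split.
- move=> x y; split=> [/coord_dist_eq0|->]; first exact: val_inj.
  exact/coord_dist_eq0.
- by move=> x y; exact: coord_dist_sym.
- by move=> x y z; exact: coord_dist_triangle.
- exact: subtype_nbhs_coord_dist.
move=> u uC.
have ucvg i : cvg ((fun n => set_val (u n) i : R) @ \oo).
  apply/cauchy_cvgP/cauchy_exP => e e0.
  have m0 : 0 < Num.min e (coord_weight R i).
    by rewrite lt_min e0 coord_weight_gt0.
  have [N NP] := uC _ m0.
  exists (set_val (u N) i); exists N => // n /= Nn.
  exact: coord_dist_lt (NP N n (leqnn _) Nn).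
pose l : {ptws I -> R} := fun i => lim ((fun n => set_val (u n) i : R) @ \oo).
have ul : (fun n => set_val (u n) : {ptws I -> R}) @ \oo --> l.
  by apply: ptws_cvg => i; exact: ucvg.
have Cl : C l.
  have uC' : \forall n \near \oo, C (set_val (u n)).
    by apply: nearW => n; exact: set_valP.
  exact: (closed_cvg C clC uC' l ul).
exists (SigSub (mem_set Cl)).
by apply: subtype_cvg.
Qed.

(** * Divergent martingales form an analytic set *)

Lemma closed_le_fun (R : realType) (X : topologicalType) (f g : X -> R) :
  continuous f -> continuous g -> closed [set x | f x <= g x].
Proof.
move=> cf cg.
rewrite (_ : [set x | _] = (fun x => g x - f x) @^-1` [set y | 0 <= y]).
  apply: preimage_closed; last exact: closed_ge.
  by move=> x _; apply: cvgB; [exact: cg | exact: cf].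
by apply/seteqP; split=> x; rewrite /= subr_ge0.
Qed.

Lemma closed_eq_fun (R : realType) (X : topologicalType) (f g : X -> R) :
  continuous f -> continuous g -> closed [set x | f x = g x].
Proof.
move=> cf cg.
rewrite (_ : [set x | _] = [set x | f x <= g x] `&` [set x | g x <= f x]).
  by apply: closedI; exact: closed_le_fun.
apply/seteqP; split=> x /=; first by move=> ->.
by move=> [fg gf]; apply/eqP; rewrite eq_le fg.
Qed.

Lemma continuous_abs_sub (R : realType) (X : topologicalType) (f g : X -> R) :
  continuous f -> continuous g -> continuous (fun x => `|f x - g x|).
Proof.
by move=> cf cg x; apply: cvg_norm; apply: cvgB; [exact: cf | exact: cg].
Qed.

Lemma continuous_mul (R : realType) (X : topologicalType) (f g : X -> R) :
  continuous f -> continuous g -> continuous (fun x => f x * g x).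
Proof. by move=> cf cg x; apply: cvgM; [exact: cf | exact: cg]. Qed.

Lemma closed_forall (X : topologicalType) (J : Type) (P : J -> set X) :
  (forall j, closed (P j)) -> closed [set x | forall j, P j x].
Proof.
move=> clP; rewrite (_ : [set x | _] = \bigcap_(j in [set: J]) P j).
  by apply: closed_bigI => j _; exact: clP.
by apply/seteqP; split=> x /= H j //; exact: H.
Qed.

(** Stated for a continuous family so as to serve both for the space of martingales and for the
    martingale coded inside [oscillation_witness]. *)
Lemma martingale_preimage_closed (R : realType) (X : topologicalType)
    (f : X -> seq bool -> R) : (forall s, continuous (f^~ s)) ->
  closed [set x | martingale R (f x)].
Proof.
move=> cf.
have cl01 s : closed [set x | 0 <= f x s <= 1].
  rewrite (_ : [set x | _] = [set x | 0 <= f x s] `&` [set x | f x s <= 1]).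
    by apply: closedI; apply: closed_le_fun => //; exact: cst_continuous.
  by apply/seteqP; split=> x /= /andP.
have clE s : closed
    [set x | f x s = (f x (rcons s false) + f x (rcons s true)) / 2].
  apply: closed_eq_fun => // x; apply: cvgMl.
  by apply: cvgD; exact: cf.
exact: closedI (closed_forall cl01) (closed_forall clE).
Qed.

Lemma martingale_polish (R : realType) : polish R (martingale R).
Proof.
apply: closed_ptws_polish.
apply: (@martingale_preimage_closed R {ptws seq bool -> R} id).
exact: ptws_eval_continuous.
Qed.

Lemma prefix_initial_segment (beta : cantor_space) p q : (p <= q)%N ->
  seq.prefix (initial_segment beta p) (initial_segment beta q).
Proof.
move=> pq; rewrite prefixE size_mkseq /initial_segment /mkseq -map_take.
by rewrite take_iota (minn_idPl pq).
Qed.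

Lemma prefix_chain_limit (u : nat -> seq bool) :
  (forall n, seq.prefix (u n) (u n.+1) && (size (u n) < size (u n.+1))%N) ->
  exists beta : cantor_space,
    forall n, initial_segment beta (size (u n)) = u n.
Proof.
move=> u_chain; have sz n : (n <= size (u n))%N.
  elim: n => // n IH; apply: leq_ltn_trans IH _.
  by have /andP[] := u_chain n.
have pre m n : (m <= n)%N -> seq.prefix (u m) (u n).
  move=> /subnKC <-; elim: (n - m)%N => [|k IH].
    by rewrite addn0 prefix_refl.
  rewrite addnS; have /andP[+ _] := u_chain (m + k)%N.
  exact: prefix_trans.
(* The string [u k.+1] is longer than [k], so it has a bit at [k], on which all sufficiently long
   [u n] agree. *)
exists (fun k => nth false (u k.+1) k) => n.
apply: (@eq_from_nth _ false) => [|k]; rewrite size_mkseq// => kn.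
rewrite nth_mkseq//.
have nthE i j : (i <= j)%N -> (k < size (u i))%N ->
    nth false (u i) k = nth false (u j) k.
  move=> /pre/prefixP[w ->] ki; by rewrite nth_cat ki.
have [kn'|nk] := leqP k.+1 n; first exact: nthE.
by rewrite -(nthE n k.+1)// ltnW.
Qed.

Section osc.
Variables (R : realType) (f : seq bool -> R) (beta : cantor_space).
Hypothesis f01 : forall s, 0 <= f s <= 1.

Let gap p q : R := `|f (initial_segment beta p) - f (initial_segment beta q)|.

Let gap_le1 p q : gap p q <= 1.
Proof.
have := f01 (initial_segment beta p); have := f01 (initial_segment beta q).
by rewrite /gap ler_norml; lra.
Qed.

(** As gaps lie in [0,1], the tail suprema [S N] are true suprema, bounded below by 0; their infimum
    vanishes iff some [S N] gets below any given [e]. *)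
Lemma osc_eq0P : osc f beta = 0 <->
  forall e, 0 < e -> exists N, forall p q, (N <= p)%N -> (N <= q)%N ->
    gap p q < e.
Proof.
pose S N := sup [set gap p q
   | p in [set p | (N <= p)%N] & q in [set q | (N <= q)%N]].
have S_ub N p q : (N <= p)%N -> (N <= q)%N -> gap p q <= S N.
  move=> Np Nq; apply: ub_le_sup; last by exists p => //; exists q.
  by exists 1 => _ [p' _ [q' _ <-]].
have S_ge0 N : 0 <= S N.
  by apply: le_trans (S_ub N N N (leqnn _) (leqnn _)); rewrite normr_ge0.
have oscE : osc f beta = inf (range S) by [].
have hasS : has_inf (range S).
  by split; [exists (S 0%N), 0%N | exists 0 => _ [N _ <-]].
rewrite oscE; split=> [S0 e e0|H].
  have [_ [N _ <-]] := inf_adherent e0 hasS.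
  rewrite S0 add0r => SN; exists N => p q Np Nq.
  exact: le_lt_trans (S_ub N p q Np Nq) SN.
apply/eqP; rewrite eq_le; apply/andP; split; last first.
  by apply: lb_le_inf; [exact: hasS.1 | move=> _ [N _ <-]].
apply/ler_addgt0Pl => e e0; rewrite addr0.
have [N NP] := H _ e0.
apply: le_trans (_ : S N <= e).
  by apply: ge_inf; [exact: hasS.2 | exists N].
apply: ge_sup.
  by exists (gap N N), N; [exact: leqnn | exists N; [exact: leqnn|]].
by move=> _ [p Np [q Nq <-]]; exact/ltW/NP.
Qed.

Lemma osc_neq0P : osc f beta <> 0 <->
  exists2 e, 0 < e & forall p, exists2 q, (p < q)%N & e <= gap p q.
Proof.
split=> [/osc_eq0P/existsNP[e /not_implyP[e0 /forallNP He]]|[e e0 He]].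
  (* If two later values differ by at least [e], one of them differs from the value at [p] by at
     least e/2. *)
  exists (e / 2) => [|p]; first by rewrite divr_gt0.
  have /existsNP[q1 /existsNP[q2]] := He p.+1.
  move=> /not_implyP[pq1 /not_implyP[pq2 /negP]].
  rewrite -leNgt => e12.
  have := ler_distD (f (initial_segment beta p))
    (f (initial_segment beta q1)) (f (initial_segment beta q2)).
  rewrite [X in _ <= X + _]distrC -/(gap q1 q2) -/(gap p q1) -/(gap p q2) => H.
  have [eq1|q1e] := leP (e / 2) (gap p q1); first by exists q1.
  by exists q2 => //; lra.
move=> /osc_eq0P/(_ _ e0)[N NP]; have [q Nq] := He N.
by rewrite leNgt NP// ltnW.
Qed.

End osc.

(** This turns the inequality of two codes into the closed condition used in
    [oscillation_witness]. *)
Lemma natr_dist_ge1 (R : realType) (a b : nat) :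
  a <> b -> 1 <= `|a%:R - b%:R : R|.
Proof.
have lt_case (m n : nat) : (m < n)%N -> 1 <= `|m%:R - n%:R : R|.
  move=> mn; have : m%:R + 1 <= n%:R :> R by rewrite natr1 ler_nat.
  by move=> mn1; rewrite ler_normr; apply/orP; right; lra.
by move=> /eqP; case: ltngtP => // /lt_case; rewrite // distrC.
Qed.

Definition decode_bits (k : nat) : seq bool := odflt [::] (unpickle k).

Lemma pickle_bitsK : cancel pickle decode_bits.
Proof. by move=> s; rewrite /decode_bits pickleK. Qed.

Section oscillation_witness.
Variable R : realType.

Let path := {ptws (seq bool + option nat)%type -> R}.

(* F codes a martingale f, a real t (which is 1 / e) and strings u_n:
   f s is F (inl s), t is F (inr None), and F (inr (Some n)) is the natural
   number coding u_n. *)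
Definition large_step (i j : nat) : set path := [set F |
  (seq.prefix (decode_bits i) (decode_bits j) &&
     (size (decode_bits i) < size (decode_bits j))%N) /\
  1 <= F (inr None) * `|F (inl (decode_bits i)) - F (inl (decode_bits j))|].

(* The conditions are phrased without existential quantifiers so as to be
   visibly closed: a nonnegative real lying in no interval ]k, k + 1[ is a
   natural number, and for such an x, "|x - i| >= 1 or P" means
   "if x = i then P". *)
Definition oscillation_witness : set path :=
  [set F | martingale R (fun s => F (inl s))] `&`
  [set F | forall n, (forall k : nat, F (inr (Some n)) <= k%:R \/
                        k.+1%:R <= F (inr (Some n))) /\
    0 <= F (inr (Some n))] `&`
  [set F | forall n (i j : nat), 1 <= `|F (inr (Some n)) - i%:R| \/
    (1 <= `|F (inr (Some n.+1)) - j%:R| \/ large_step i j F)].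

Lemma large_step_closed i j : closed (large_step i j).
Proof.
have c_eval k : continuous (fun F : path => F k : R).
  exact: ptws_eval_continuous.
have c_gap k l : continuous (fun F : path => `|F k - F l|).
  exact: continuous_abs_sub.
have cl_bool (b : bool) : closed [set F : path | b].
  case: b; first by rewrite (_ : [set _ | _] = setT) ?predeqE//; exact: closedT.
  by rewrite (_ : [set _ | _] = set0) ?predeqE//; exact: closed0.
apply: closedI (cl_bool _) _.
apply: closed_le_fun; first exact: cst_continuous.
exact: continuous_mul (c_eval _) (c_gap _ _).
Qed.

Lemma oscillation_witness_closed : closed oscillation_witness.
Proof.
have c_eval k : continuous (fun F : path => F k : R).
  exact: ptws_eval_continuous.
have c_cst (r : R) : continuous (fun F : path => r).
  exact: cst_continuous.
have c_dist k (r : R) : continuous (fun F : path => `|F k - r|).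
  exact: continuous_abs_sub.
apply: closedI; first apply: closedI.
- by apply: martingale_preimage_closed => s; exact: c_eval.
- have cl_nat n k : closed [set F : path |
      F (inr (Some n)) <= k%:R \/ k.+1%:R <= F (inr (Some n))].
    exact: closedU (closed_le_fun (c_eval _) (c_cst _))
                   (closed_le_fun (c_cst _) (c_eval _)).
  apply: closed_forall => n; apply: closedI (closed_forall (cl_nat n)) _.
  exact: closed_le_fun.
apply: closed_forall => n; apply: closed_forall => i.
apply: closed_forall => j.
have cl_far k (m : nat) : closed [set F : path | 1 <= `|F k - m%:R|].
  exact: closed_le_fun.
exact: closedU (cl_far _ _) (closedU (cl_far _ _) (@large_step_closed i j)).
Qed.

Lemma oscillation_witnessP (f : seq bool -> R) : martingale R f ->
  (exists beta, osc f beta <> 0) <->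
  (exists2 F, oscillation_witness F & f = (fun s => F (inl s))).
Proof.
move=> Mf; have f01 := Mf.1; split=> [[beta /(osc_neq0P beta f01)[e e0 He]]|].
  have [phi phi_gt phiP] : exists2 phi : nat -> nat, forall p, (p < phi p)%N &
      forall p, e <= `|f (initial_segment beta p)
                       - f (initial_segment beta (phi p))|.
    have /choice[phi phiP] : forall p, exists q, (p < q)%N /\
      e <= `|f (initial_segment beta p) - f (initial_segment beta q)|.
      by move=> p; have [q] := He p; exists q.
    by exists phi => p; have [] := phiP p.
  pose u n := initial_segment beta (iter n phi 0%N).
  pose F (x : seq bool + option nat) : R := match x with
    | inl s => f s | inr None => e^-1 | inr (Some n) => (pickle (u n))%:R end.
  exists F => //; split=> [|n i j]; first split=> // n.
    split=> [k|]; rewrite /F ?ler0n// !ler_nat.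
    by have [|] := leqP (pickle (u n)) k; [left | right].
  have [ui|/eqP/(natr_dist_ge1 R)] := eqVneq (pickle (u n)) i; last by left.
  have [uj|/eqP/(natr_dist_ge1 R)] := eqVneq (pickle (u n.+1)) j; last first.
    by right; left.
  right; right; rewrite -ui -uj /large_step /= !pickle_bitsK !size_mkseq.
  rewrite prefix_initial_segment ?(ltnW (phi_gt _)) ?phi_gt//; split=> //.
  rewrite mulrC ler_pdivlMr// mul1r; exact: phiP.
move=> [F [[_ Fnat] Fstep] fE]; rewrite {}fE in Mf f01 *.
have /choice[c cP] : forall n, exists c : nat, F (inr (Some n)) = c%:R.
  move=> n; have [Fk F0] := Fnat n.
  (* The value lies in [k, k+1[ for its truncation k, and the witness condition at this k leaves
     only k itself. *)
  exists (Num.truncn (F (inr (Some n)))).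
  have /andP[lo hi] := truncn_itv F0.
  have [le|ge] := Fk (Num.truncn (F (inr (Some n)))).
    by apply/eqP; rewrite eq_le le.
  by move: hi; rewrite ltNge ge.
have step n : seq.prefix (decode_bits (c n)) (decode_bits (c n.+1)) &&
     (size (decode_bits (c n)) < size (decode_bits (c n.+1)))%N /\
   1 <= F (inr None)
        * `|F (inl (decode_bits (c n))) - F (inl (decode_bits (c n.+1)))|.
  (* At the actual codes both distance alternatives read 1 <= 0, so [large_step] holds. *)
  have := Fstep n (c n) (c n.+1).
  by rewrite !cP !subrr !normr0 ler10; case=> [//|[//|]].
have [beta betaP] := prefix_chain_limit (fun n => (step n).1).
exists beta => /(osc_eq0P beta f01) osc0.
(* Positivity, an open condition, is extracted from the closed condition [1 <= t * gap]; this is why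
   1/e is coded rather than e. *)
have t0 : 0 < F (inr None).
  have [_ s1] := step 0%N; rewrite ltNge; apply/negP => tle; move: s1.
  by rewrite leNgt (le_lt_trans (mulr_le0_ge0 tle (normr_ge0 _)) ltr01).
have [|N NP] := osc0 (F (inr None))^-1; first by rewrite invr_gt0.
have sz n : (n <= size (decode_bits (c n)))%N.
  elim: n => // n IH; apply: leq_ltn_trans IH _.
  by have [/andP[]] := step n.
have := NP _ _ (sz N) (leq_trans (leqnSn N) (sz N.+1)).
rewrite !betaP; apply/negP; rewrite -leNgt.
by have [_] := step N; rewrite mulrC -ler_pdivrMr// mul1r.
Qed.

End oscillation_witness.
Arguments oscillation_witness R : clear implicits.

Lemma everywhere_converging_coanalytic (R : realType) :
  coanalytic R (everywhere_converging R).
Proof.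
exists (set_type (oscillation_witness R)); split.
  exact/closed_ptws_polish/oscillation_witness_closed.
have MF (F : oscillation_witness R) :
    martingale R (fun s => set_val F (inl s)).
  by have [[]] := set_valP F.
pose g (F : oscillation_witness R) : martingale R := SigSub (mem_set (MF F)).
exists g.
  move=> F; have FF : Filter (g @ nbhs F) by exact: fmap_filter (nbhs_filter F).
  apply: subtype_ptws_cvg => s.
  exact: (@subtype_eval_continuous R _ _ (inl s) F).
apply/seteqP; split=> [f /existsNP fosc|_ [F _ <-]].
  have /(oscillation_witnessP (set_valP f))[F HF fF] := fosc.
  by exists (SigSub (mem_set HF)) => //; exact: val_inj.
apply/existsNP; apply/(oscillation_witnessP (set_valP (g F))).
by exists (set_val F); [exact: set_valP | ].
Qed.

(** * The martingale of a tree on the natural numbers *)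

Section branch_martingale.
Variable R : realType.

(* Value at the string x when the blocks read so far code s and a zeros of the
   current block have been read.  After 0^a 1 the martingale moves by 1/4 with
   the next bit, and comes back to 1/2 only if the following bit is also 0. *)
Fixpoint branch_martingale (T : seq nat -> bool) (s : seq nat) (a : nat)
    (x : seq bool) {struct x} : R :=
  match x with
  | [::] => 1 / 2
  | false :: x' => branch_martingale T s a.+1 x'
  | true :: x' =>
    if T (rcons s a) then
      match x' with
      | [::] => 1 / 2
      | true :: _ => 1 / 4
      | false :: [::] => 3 / 4
      | false :: true :: _ => 1
      | false :: false :: x'' => branch_martingale T (rcons s a) 0 x''
      end
    else 1 / 2
  end.

Lemma branch_martingale_bounds T s a x :
  0 <= branch_martingale T s a x <= 1.
Proof.
(* Induction on the length, since a completed block removes three bits at once. *)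
have [n] := ubnP (size x); elim: n => // n IH in s a x *.
case: x => [|[] x] /= szx; [lra | | exact: IH].
case: (T _); last by lra.
case: x szx => [|[] [|[] x]] szx; try lra.
by apply: IH; move: szx; rewrite /= !ltnS => /ltnW/ltnW.
Qed.

(** Inside an accepted block, 1/2 is the mean of 3/4 and 1/4, and 3/4 the mean of 1/2 and 1; at all
    other strings both successors keep the value. *)
Lemma branch_martingaleE T s a x : branch_martingale T s a x =
  (branch_martingale T s a (rcons x false) +
   branch_martingale T s a (rcons x true)) / 2.
Proof.
have [n] := ubnP (size x); elim: n => // n IH in s a x *.
case: x => [|[] x] szx; rewrite ?rcons_cons.
- by rewrite /=; case: (T _); lra.
- rewrite /=; case: (T _); last by lra.
  case: x szx => [|[] [|[] x]] szx /=; try lra.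
  by apply: IH; move: szx; rewrite /= !ltnS => /ltnW/ltnW.
- by rewrite /=; exact: IH.
Qed.

Lemma branch_martingaleP T : martingale R (branch_martingale T [::] 0).
Proof.
by split=> s; [exact: branch_martingale_bounds | exact: branch_martingaleE].
Qed.

Lemma continuous_if_clopen (Z : topologicalType) (b : Z -> bool)
    (f g : Z -> R) : clopen [set z | b z] -> continuous f -> continuous g ->
  continuous (fun z => if b z then f z else g z).
Proof.
move=> [ob cb] cf cg z; rewrite /continuous_at; have [bz|nbz] := boolP (b z).
  have nb : \forall z' \near z, f z' = if b z' then f z' else g z'.
    have : nbhs z [set z | b z] by exact: open_nbhs_nbhs.
    by apply: filterS => z' /= ->.
  exact: (cvg_trans (near_eq_cvg nb) (cf z)).
have nb : \forall z' \near z, g z' = if b z' then f z' else g z'.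
  have : nbhs z (~` [set z | b z]).
    by apply: open_nbhs_nbhs; split; [exact: closed_openC | exact/negP].
  by apply: filterS => z' /= /negP/negbTE ->.
exact: (cvg_trans (near_eq_cvg nb) (cg z)).
Qed.

(** On a fixed string the value depends on finitely many tests [T z s], each locally constant in
    [z]. *)
Lemma branch_martingale_continuous (Z : topologicalType)
    (T : Z -> seq nat -> bool) : (forall s, clopen [set z | T z s]) ->
  forall s a x, continuous (fun z => branch_martingale (T z) s a x).
Proof.
move=> clT s a x; have [n] := ubnP (size x); elim: n => // n IH in s a x *.
have cc (r : R) : continuous (fun z : Z => r) by exact: cst_continuous.
case: x => [|[] x] /= szx; [exact: cc | | exact: IH].
apply: continuous_if_clopen => //.
case: x szx => [|[] [|[] x]] /= szx; try exact: cc.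
by apply: IH; move: szx; rewrite !ltnS => /ltnW/ltnW.
Qed.

Lemma branch_martingale_zeros T s a k x :
  branch_martingale T s a (nseq k false ++ x) =
  branch_martingale T s (a + k)%N x.
Proof. by elim: k => [|k IH] in a *; rewrite ?addn0//= IH addSnnS. Qed.

Lemma branch_martingale_block (T : seq nat -> bool) s k x : T (rcons s k) ->
  branch_martingale T s 0 (nseq k false ++ [:: true, false, false & x]) =
  branch_martingale T (rcons s k) 0 x.
Proof. by move=> Tk; rewrite branch_martingale_zeros add0n /= Tk. Qed.

Lemma branch_osc (T : seq nat -> bool) (alpha : nat -> nat) :
  (forall n, T (mkseq alpha n.+1)) ->
  exists beta, osc (branch_martingale T [::] 0) beta <> 0.
Proof.
move=> Talpha.
pose fix u n := if n is n'.+1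
  then u n' ++ nseq (alpha n') false ++ [:: true; false; false] else [::].
have mkS n : mkseq alpha n.+1 = rcons (mkseq alpha n) (alpha n).
  by rewrite /mkseq -addn1 iotaD map_cat cats1.
have uE n y : branch_martingale T [::] 0 (u n ++ y) =
    branch_martingale T (mkseq alpha n) 0 y.
  elim: n y => //= n IH y.
  rewrite -!catA IH mkS; apply: branch_martingale_block.
  by rewrite -mkS.
have u_chain n :
    seq.prefix (u n) (u n.+1) && (size (u n) < size (u n.+1))%N.
  by rewrite /= prefix_prefix /= !size_cat /= -[ltnLHS]addn0 ltn_add2l addn3.
have [beta betaP] := prefix_chain_limit u_chain.
exists beta; apply/(osc_neq0P _ (branch_martingale_bounds T [::] 0)).
(* Half the distance from 1/2 to 3/4: every real is at least 1/8 away from one of the two. *)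
exists (1 / 8) => [|p]; first by lra.
have sz n : (n <= size (u n))%N.
  elim: n => // n IH; apply: leq_ltn_trans IH _.
  by have /andP[] := u_chain n.
have [n pn] : exists n, (p < size (u n))%N by exists p.+1; exact: sz.
(* This is [u n.+1] without its last bit, where the excursion to 3/4 takes place. *)
pose v := u n ++ nseq (alpha n) false ++ [:: true; false].
have vE : initial_segment beta (size v) = v.
  have uv : u n.+1 = v ++ [:: false] by rewrite /= /v -!catA.
  have le_v : (size v <= size (u n.+1))%N by rewrite uv size_cat leq_addr.
  have /prefixP[w] := prefix_initial_segment beta le_v.
  rewrite betaP uv => /eqP; rewrite eqseq_cat ?size_mkseq// => /andP[/eqP <-].
  by [].
have valv : branch_martingale T [::] 0 v = 3 / 4.
  rewrite /v uE branch_martingale_zeros /= add0n.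
  by rewrite -mkS Talpha.
have valu : branch_martingale T [::] 0 (u n) = 1 / 2.
  by rewrite -[u n]cats0 uE.
set c := branch_martingale T [::] 0 (initial_segment beta p).
have [cu|cu] := leP (1 / 8) `|c - 1 / 2|.
  by exists (size (u n)); [exact: pn | rewrite betaP valu].
exists (size v); first by rewrite /v size_cat ltn_addr.
rewrite vE valv -/c; move: cu; rewrite ltr_norml ler_normr; lra.
Qed.

(** The values along [gamma], read after the blocks [s], are not eventually constant. This follows
    from divergence and, unlike a fixed gap [e], needs no bookkeeping when passing to the tail after
    a block. *)
Let unstable T s (gamma : nat -> bool) := forall N c, exists2 p, (N <= p)%N &
  branch_martingale T s 0 (mkseq gamma p) <> c.

(** Each deviation freezes the value: only zeros or a block refused by [T] gives 1/2, the bits 11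
    give 1/4 and 101 gives 1. So [gamma] starts with an accepted block 0^k 100, and [gamma'] is what
    follows it. *)
Lemma unstable_step T s gamma : unstable T s gamma ->
  exists k gamma', T (rcons s k) /\ unstable T (rcons s k) gamma'.
Proof.
move=> uns; have [gex|no1] := pselect (exists k, gamma k); last first.
  have [p _ pc] := uns 0%N (1 / 2); exfalso; apply: pc.
  rewrite (_ : mkseq gamma p = nseq p false ++ [::]).
    by rewrite branch_martingale_zeros.
  apply: (@eq_from_nth _ false) => [|i].
    by rewrite cats0 size_mkseq size_nseq.
  rewrite size_mkseq => ip; rewrite cats0 nth_mkseq// nth_nseq ip.
  by apply: contra_notF no1 => gi; exists i.
case: (ex_minnP gex) => {gex}k gk k_min.
pose gamma' i := gamma (k + 3 + i)%N.
have mkE p : mkseq gamma (k + 3 + p) = nseq k false ++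
    [:: true, gamma k.+1, gamma k.+2 & mkseq gamma' p].
  rewrite /mkseq -addnA !iotaD !map_cat /=; congr cat.
    apply: (@eq_from_nth _ false) => [|i]; rewrite size_map size_iota.
      by rewrite size_nseq.
    move=> ik; rewrite (nth_map 0%N) ?size_iota// nth_iota// nth_nseq ik.
    by apply: contra_ltnF ik; exact: k_min.
  rewrite add0n gk; do 3 congr cons.
  rewrite -[X in iota X](addn0 (k + 3)) iotaDl -map_comp.
  by apply: eq_map => i.
have stable c : (forall p, branch_martingale T s 0 (nseq k false ++
    [:: true, gamma k.+1, gamma k.+2 & mkseq gamma' p]) = c) -> False.
  move=> cE; have [p + []] := uns (k + 3)%N c.
  by move=> /subnKC <-; rewrite mkE.
have valE p : branch_martingale T s 0 (nseq k false ++
    [:: true, gamma k.+1, gamma k.+2 & mkseq gamma' p]) =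
  branch_martingale T s k [:: true, gamma k.+1, gamma k.+2 & mkseq gamma' p].
  exact: branch_martingale_zeros.
exists k, gamma'.
move: mkE valE stable; rewrite /=.
case Tk : (T _); last by move=> _ valE /(_ (1 / 2))[].
case: (gamma k.+1); first by move=> _ valE /(_ (1 / 4))[].
case: (gamma k.+2); first by move=> _ valE /(_ 1)[].
move=> mkE valE _; split=> // N c.
have [p Np] := uns (k + 3 + N)%N c.
have k3p : (k + 3 <= p)%N by exact: leq_trans (leq_addr _ _) Np.
rewrite -(subnKC k3p) mkE valE => pc.
by exists (p - (k + 3))%N; rewrite // leq_subRL.
Qed.

Lemma osc_branch (T : seq nat -> bool) beta :
  osc (branch_martingale T [::] 0) beta <> 0 ->
  exists alpha, forall n, T (mkseq alpha n.+1).
Proof.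
move=> /(osc_neq0P _ (branch_martingale_bounds T [::] 0))[e e0 He].
have uns0 : unstable T [::] beta.
  move=> N c; have [//|Nc] := pselect (exists2 p, (N <= p)%N &
    branch_martingale T [::] 0 (mkseq beta p) <> c).
  have cE p : (N <= p)%N -> branch_martingale T [::] 0 (mkseq beta p) = c.
    by move=> Np; apply: contrapT => pc; apply: Nc; exists p.
  have [q Nq] := He N; rewrite /initial_segment !cE ?(ltnW Nq)//.
  by rewrite subrr normr0 leNgt e0.
have /choice[next nextP] : forall x : seq nat * (nat -> bool),
    exists y : nat * (nat -> bool), unstable T x.1 x.2 ->
      T (rcons x.1 y.1) /\ unstable T (rcons x.1 y.1) y.2.
  move=> [s gamma]; have [uns|nuns] := pselect (unstable T s gamma).
    by have [k [gamma' H]] := unstable_step uns; exists (k, gamma').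
  (* A dummy choice: the implication is vacuous here. *)
  by exists (0%N, gamma).
pose st n := iter n (fun x => (rcons x.1 (next x).1, (next x).2))
  ([::], beta : nat -> bool).
have uns n : unstable T (st n).1 (st n).2.
  by elim: n => // n IH; have [] := nextP _ IH.
pose alpha n := (next (st n)).1.
exists alpha => n; suff stE m : (st m).1 = mkseq alpha m.
  by rewrite -stE; have [] := nextP _ (uns n).
elim: m => // m IH; rewrite /= -/(st m) IH.
by rewrite /mkseq -[in RHS]addn1 iotaD map_cat cats1.
Qed.

End branch_martingale.

(** * Reduction of coanalytic sets *)

(** A Lindelöf argument: for each point of the countable dense set and each radius 1/(j+1), pick a
    member of [Q] containing that ball, if any. The empty set fills the remaining indices. *)
Lemma countable_subcover (R : realType) (X : topologicalType)
    (Q : set (set X)) : polish R X -> Q set0 ->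
    (forall x : X, exists2 V, nbhs x V & Q V) ->
  exists W : nat -> set X, (forall k, Q (W k)) /\ forall x, exists k, W k x.
Proof.
move=> [[S cS dS] [d [_ d_sym d_tri nbhsP _]]] Q0 Qcover.
have /countable_injP[idx idx_inj] := cS.
pose good (c : nat * nat) (V : set X) := Q V /\ exists x, [/\ S x, idx x = c.1 &
  [set y | d x y < c.2.+1%:R^-1] `<=` V].
pose W k := if unpickle k is Some c then xget set0 (good c) else set0.
exists W; split=> [k|x].
  rewrite /W; case: (unpickle k) => // c.
  by case: xgetP => // V _ [].
have [V nV QV] := Qcover x; have [e e0 eV] := (nbhsP x V).1 nV.
have e20 : 0 < e / 2 by rewrite divr_gt0.
have [j] := ltr_add_invr e20; rewrite add0r => je.
have j0 : 0 < j.+1%:R^-1 :> R by rewrite invr_gt0 ltr0n.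
have nx : nbhs x [set y | d x y < j.+1%:R^-1].
  by apply/nbhsP; exists j.+1%:R^-1.
have [s [/interior_subset/= xs Ss]] :
    [set y | d x y < j.+1%:R^-1]^° `&` S !=set0.
  by apply: dS; [exists x; exact: nx | exact: open_interior].
have goodV : good (idx s, j) V.
  split=> //; exists s; split=> // y /= sy; apply: eV => /=.
  apply: le_lt_trans (d_tri x s y) _.
  by rewrite [e]splitr ltrD// (lt_trans _ je).
exists (pickle (idx s, j)); rewrite /W pickleK.
have [_ [s' [Ss' ss' +]]] : good (idx s, j) (xget set0 (good (idx s, j))).
  by case: xgetP => [//|/(_ V)].
by rewrite (idx_inj s' s) ?inE//; apply; rewrite /= d_sym.
Qed.

Lemma clopen_finite_meet (Z : topologicalType) (W : nat -> set Z) n :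
  (forall i, clopen (W i)) -> clopen [set z | forall i, (i < n)%N -> W i z].
Proof.
move=> clW; elim: n => [|n IH].
  rewrite (_ : [set z | _] = setT).
    by split; [exact: openT | exact: closedT].
  by apply/seteqP; split.
rewrite (_ : [set z | _] = [set z | forall i, (i < n)%N -> W i z] `&` W n).
  exact: clopenI.
apply/seteqP; split=> z /= => [H|[H Wn] i].
  by split=> [i /ltnW|]; exact: H.
by rewrite ltnS leq_eqVlt => /orP[/eqP->//|]; exact: H.
Qed.

Definition decode_pair (m : nat) : nat * nat := odflt (0, 0)%N (unpickle m).

Lemma pickle_pairK : cancel pickle decode_pair.
Proof. by move=> c; rewrite /decode_pair pickleK. Qed.

Section analytic_tree.
Variables (Y Z : Type) (h : Y -> Z).
Variables (B : nat -> nat -> set Y) (W : nat -> nat -> set Z).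

(* The letter at position i of s codes a pair (k, l), standing for the cells
   B i k and W i l. *)
Definition analytic_tree (z : Z) (s : seq nat) : bool :=
  `[< (exists y, forall i, (i < size s)%N ->
         B i (decode_pair (nth 0%N s i)).1 y /\
         W i (decode_pair (nth 0%N s i)).2 (h y)) /\
      forall i, (i < size s)%N -> W i (decode_pair (nth 0%N s i)).2 z >].

End analytic_tree.

(** The existential half does not mention [z]: if it fails the set is empty, otherwise a finite
    intersection of clopen cells remains. *)
Lemma analytic_tree_clopen (Y : Type) (Z : topologicalType) (h : Y -> Z)
    (B : nat -> nat -> set Y) (W : nat -> nat -> set Z) s :
  (forall i k, clopen (W i k)) -> clopen [set z | analytic_tree h B W z s].
Proof.
move=> clW.
set E := exists y, forall i, (i < size s)%N ->
  B i (decode_pair (nth 0%N s i)).1 y /\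
  W i (decode_pair (nth 0%N s i)).2 (h y).
have [HE|nE] := pselect E.
  rewrite (_ : [set z | _] = [set z | forall i, (i < size s)%N ->
      W i (decode_pair (nth 0%N s i)).2 z]).
    exact: clopen_finite_meet.
  by apply/seteqP; split=> z /= => [/asboolP[]|Hz] //; exact/asboolP.
rewrite (_ : [set z | _] = set0); first by split; [exact: open0|exact: closed0].
by apply/seteqP; split=> z //= /asboolP[].
Qed.

(** A point [y] above [z] yields a branch by naming the cells of [y] and [h y]. Conversely, the
    points [u n] witnessing a branch share ever smaller cells of [Y], so they converge to some [y];
    as [h (u n)] and [z] share a cell of scale [n], continuity gives [h y = z]. *)
Lemma analytic_treeP (R : realType) (Y Z : topologicalType) (h : Y -> Z)
    (B : nat -> nat -> set Y) (W : nat -> nat -> set Z)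
    (dY : Y -> Y -> R) (dZ : Z -> Z -> R) (z : Z) :
  (forall x (A : set Y), nbhs x A <->
    exists2 e, 0 < e & [set y | dY x y < e] `<=` A) ->
  (forall u : nat -> Y, (forall e, 0 < e -> exists N, forall m n,
     (N <= m)%N -> (N <= n)%N -> dY (u m) (u n) < e) ->
     exists l : Y, u @ \oo --> l) ->
  (forall x y, dZ x y = 0 <-> x = y) -> (forall x y, dZ x y = dZ y x) ->
  (forall x y w, dZ x w <= dZ x y + dZ y w) ->
  (forall x (A : set Z), nbhs x A <->
    exists2 e, 0 < e & [set y | dZ x y < e] `<=` A) ->
  continuous h ->
  (forall i y, exists k, B i k y) -> (forall i x, exists k, W i k x) ->
  (forall i k x y, B i k x -> B i k y -> dY x y < i.+1%:R^-1) ->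
  (forall i k x y, W i k x -> W i k y -> dZ x y < i.+1%:R^-1) ->
  range h z <->
  exists alpha, forall n, analytic_tree h B W z (mkseq alpha n.+1).
Proof.
move=> nbhsY complY dZ0 dZ_sym dZ_tri nbhsZ ch coverB coverW smallB smallW.
split=> [[y _ <-]|[alpha Halpha]].
  have /choice[k Bk] : forall i, exists k, B i k y by [].
  have /choice[l Wl] : forall i, exists l, W i l (h y) by [].
  exists (fun i => pickle (k i, l i)) => n; apply/asboolP.
  rewrite size_mkseq; split=> [|i iN]; last by rewrite nth_mkseq// pickle_pairK.
  by exists y => i iN; rewrite nth_mkseq// pickle_pairK.
have {}Halpha n : exists y, forall i, (i < n.+1)%N ->
    B i (decode_pair (alpha i)).1 y /\
    W i (decode_pair (alpha i)).2 (h y) /\ W i (decode_pair (alpha i)).2 z.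
  have /asboolP[[y]] := Halpha n; rewrite size_mkseq => Hy Hz.
  exists y => i iN; have := Hy i iN; have := Hz i iN.
  by rewrite nth_mkseq// => ? [].
have /choice[u uP] := Halpha.
have [y uy] : exists y : Y, u @ \oo --> y.
  apply: complY => e e0; have [N] := ltr_add_invr e0; rewrite add0r => Ne.
  exists N => m n Nm Nn; apply: lt_trans Ne.
  have [Bm _] := uP m N Nm; have [Bn _] := uP n N Nn.
  exact: smallB Bm Bn.
have huy : (h \o u) @ \oo --> h y by exact: cvg_comp uy (ch y).
exists y => //; apply/dZ0/eqP; rewrite eq_le; apply/andP; split; last first.
  (* Nonnegativity, from 0 = d(hy,hy) <= 2 d(hy,z). *)
  have := dZ_tri (h y) z (h y); rewrite (dZ_sym z) (dZ0 (h y) (h y)).2//; lra.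
apply/ler_addgt0Pl => e e0; rewrite addr0.
have e20 : 0 < e / 2 by rewrite divr_gt0.
have [M] := ltr_add_invr e20; rewrite add0r => Me.
have : nbhs (h y) [set x | dZ (h y) x < e / 2] by apply/nbhsZ; exists (e / 2).
move=> /huy[N _ NP]; have := NP _ (leq_maxl N M); rewrite /=.
set n := maxn N M => hn.
have [_ [Wn Wz]] := uP n n (leqnn _).
apply: le_trans (dZ_tri _ (h (u n)) _) _; rewrite [e]splitr ltW// ltrD//.
apply: lt_trans (smallW _ _ _ _ Wn Wz) _; apply: le_lt_trans Me.
by rewrite lef_pV2 ?posrE ?ltr0n// ler_nat ltnS leq_maxr.
Qed.

Lemma coanalytic_reduction (R : realType) (Z : topologicalType) (D : set Z) :
  polish R Z -> has_clopen_basis Z -> coanalytic R D ->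
  exists2 g : Z -> martingale R, continuous g &
    D = g @^-1` everywhere_converging R.
Proof.
move=> polZ [_ basisZ] [Y [polY [h ch DE]]].
have [_ [dY [dY0 dY_sym dY_tri nbhsY complY]]] := polY.
have [_ [dZ [dZ0 dZ_sym dZ_tri nbhsZ _]]] := polZ.
have inv_gt0 i : 0 < i.+1%:R^-1 / 2 :> R by rewrite divr_gt0// invr_gt0 ltr0n.
have small (T : Type) (dT : T -> T -> R) x y y' i :
    (forall x y, dT x y = dT y x) ->
    (forall x y z, dT x z <= dT x y + dT y z) ->
    dT x y < i.+1%:R^-1 / 2 -> dT x y' < i.+1%:R^-1 / 2 ->
    dT y y' < i.+1%:R^-1.
  move=> dsym dtri xy xy'; apply: le_lt_trans (dtri _ x _) _.
  by rewrite [ltRHS]splitr ltrD// dsym.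
have /choice[B HB] : forall i, exists B : nat -> set Y,
    (forall k x y, B k x -> B k y -> dY x y < i.+1%:R^-1) /\
    forall y, exists k, B k y.
  move=> i; pose Q := [set V : set Y | forall x y, V x -> V y ->
    dY x y < i.+1%:R^-1].
  have [||B [QB coverB]] := @countable_subcover R Y Q polY.
  - by move=> x y [].
  - move=> y; exists [set y' | dY y y' < i.+1%:R^-1 / 2].
      by apply/nbhsY; exists (i.+1%:R^-1 / 2).
    by move=> a b /=; exact: small.
  by exists B; split=> // k; exact: QB.
have /choice[W HW] : forall i, exists W : nat -> set Z,
    ((forall k, clopen (W k)) /\
     (forall k x y, W k x -> W k y -> dZ x y < i.+1%:R^-1)) /\
    forall z, exists k, W k z.
  move=> i; pose Q := [set V : set Z | clopen V /\ forall x y, V x -> V y ->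
    dZ x y < i.+1%:R^-1].
  have [||W [QW coverW]] := @countable_subcover R Z Q polZ.
  - by split=> //; split; [exact: open0 | exact: closed0].
  - move=> z; have : nbhs z [set z' | dZ z z' < i.+1%:R^-1 / 2].
      by apply/nbhsZ; exists (i.+1%:R^-1 / 2).
    (* Zero-dimensionality enters here: the ball is shrunk to a clopen cell. *)
    move=> /basisZ[V [clV Vz] VS]; exists V.
      by apply: open_nbhs_nbhs; split=> //; exact: clV.1.
    by split=> // a b /VS + /VS; exact: small.
  by exists W; split=> //; split=> k; have [] := QW k.
pose T z := analytic_tree h B W z.
have clT s : clopen [set z | T z s].
  by apply: analytic_tree_clopen => i k; exact: (HW i).1.1.
pose g z : martingale R := SigSub (mem_set (branch_martingaleP R (T z))).
exists g.
  move=> z; have FF : Filter (g @ nbhs z) by exact: fmap_filter (nbhs_filter z).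
  apply: subtype_ptws_cvg => s.
  exact: (branch_martingale_continuous clT).
have rangeP z : range h z <-> exists beta, osc (set_val (g z)) beta <> 0.
  have treeP : range h z <-> exists alpha, forall n, T z (mkseq alpha n.+1).
    exact: (analytic_treeP z nbhsY complY dZ0 dZ_sym dZ_tri nbhsZ ch
      (fun i => (HB i).2) (fun i => (HW i).2)
      (fun i => (HB i).1) (fun i => (HW i).1.2)).
  rewrite treeP; split=> [[alpha]|[beta]]; first exact: branch_osc.
  exact: osc_branch.
apply/seteqP; split=> z /=.
  move=> Dz beta; apply: contrapT => nosc.
  by have : (~` D) z by rewrite DE; apply/rangeP; exists beta.
move=> conv; apply: contrapT => nD.
have : range h z by rewrite -DE.
by move=> /rangeP[beta]; apply; exact: conv.
Qed.

Theorem theorem1p6 (R : realType) : Pi11_complete R (everywhere_converging R).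
Proof.
split; first exact: martingale_polish.
- exact: everywhere_converging_coanalytic.
- by move=> Z polZ basisZ D coD; exact: coanalytic_reduction.
Qed.
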